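(* Let $\sigma\in M^0_{\rho,\Lambda}(\mathbb{Z}\times\mathbb{T})$. Then for all compact operators $K$ on $\ell^2(\mathbb{Z})$, $$\|T_\sigma-K\|_{**}\ge d,\qquad\text{where}\quad d=\limsup_{|k|\to\infty}\Big\{\sup_{x\in[-\pi,\pi]}|\sigma(k,x)|\Big\},$$ and $\|\cdot\|_{**}$ denotes the norm in the $C^*$-algebra of all bounded linear operators on $\ell^2(\mathbb{Z})$.
   Context: $\mathbb{N}_0=\{0,1,2,\dots\}$, and $\mathbb{T}=\mathbb{R}/2\pi\mathbb{Z}$ is the one-dimensional torus, identified with $[-\pi,\pi]$ with endpoints identified. For a function $a$ of $k\in\mathbb{Z}$, $\Delta_k a(k)=a(k+1)-a(k)$ and $\Delta_k^\alpha$ is its $\alpha$-th iterate. Weight function: $\Lambda:\mathbb{Z}\to(0,\infty)$ is a fixed function for which there are positive constants $\mu_0\le\mu_1$, $C_0,C_1$ with $C_0(1+|k|)^{\mu_0}\le\Lambda(k)\le C_1(1+|k|)^{\mu_1}$ for all $k\in\mathbb{Z}$. Moreover there is a real constant $\mu\ge\mu_1$ such that for all $\alpha\in\mathbb{N}_0$ and $\gamma\in\{0,1\}$ there is $C_{\alpha,\gamma}>0$ with $|k^\gamma\Delta_k^{\alpha+\gamma}\Lambda(k)|\le C_{\alpha,\gamma}\Lambda(k)^{1-\alpha/\mu}$ for all $k\in\mathbb{Z}$. Fix $\rho\in(0,1/\mu]$. Symbol class: for $m\in\mathbb{R}$, $M^m_{\rho,\Lambda}(\mathbb{Z}\times\mathbb{T})$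 is the set of functions $\sigma:\mathbb{Z}\times\mathbb{T}\to\mathbb{C}$, smooth in $x\in\mathbb{T}$ for every $k\in\mathbb{Z}$, such that for all $\alpha,\beta\in\mathbb{N}_0$ and $\gamma\in\{0,1\}$ there is $C_{\alpha,\beta,\gamma}>0$ with $|\Delta_k^\alpha\partial_x^\beta\big(k^\gamma\Delta_k^\gamma\sigma(k,x)\big)|\le C_{\alpha,\beta,\gamma}\Lambda(k)^{m-\rho\alpha}$ for all $(k,x)\in\mathbb{Z}\times\mathbb{T}$. The pseudo-differential operator on $\mathbb{Z}$ with symbol $\sigma$ is $$T_\sigma f(k)=(2\pi)^{-1}\int_{-\pi}^{\pi}e^{ikx}\sigma(k,x)\widehat f(x)\,dx,\quad \widehat f(x)=\sum_{l\in\mathbb{Z}}f(l)e^{-ilx},\quad k\in\mathbb{Z}.$$ For $\sigma\in M^0_{\rho,\Lambda}(\mathbb{Z}\times\mathbb{T})$ it is a bounded linear operator on $\ell^2(\mathbb{Z})$. *)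

(* Defs.v *)
From mathcomp Require Export all_boot all_order all_algebra.
From mathcomp Require Export all_classical all_reals all_analysis.
From mathcomp Require Export complex.
Export Order.TTheory GRing.Theory Num.Theory.
Export numFieldNormedType.Exports.

#[export] Set Implicit Arguments.
#[export] Unset Strict Implicit.
#[export] Unset Printing Implicit Defensive.

#[export] Set Warnings "-notation-overridden".

Local Open Scope classical_set_scope.
Local Open Scope ring_scope.
Local Open Scope complex_scope.

Section Complex.
Variable R : realType.
Local Notation C := R[i].
Implicit Types (f g : R -> C) (z : C).

(* The R-valued modulus; the library's `|z| is C-valued. *)
Definition cabs z : R := ComplexField.Normc.normc z.

Definition expi (t : R) : C := cos t +i* sin t.

Definition cre f : R -> R := fun x => complex.Re (f x).
Definition cim f : R -> R := fun x => complex.Im (f x).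

Definition cderiv (n : nat) f : R -> C :=
  fun x => derive1n n (cre f) x +i* derive1n n (cim f) x.

Definition csmooth f : Prop := forall (n : nat) (x : R),
  derivable (derive1n n (cre f)) x 1 /\ derivable (derive1n n (cim f)) x 1.

Definition torus : set R := `[- pi, pi].

Definition cintegral f : C :=
  (\int[lebesgue_measure]_(x in torus) cre f x) +i*
  (\int[lebesgue_measure]_(x in torus) cim f x).

Definition cmeasurable (D : set R) f : Prop :=
  measurable_fun D (cre f) /\ measurable_fun D (cim f).

End Complex.

Arguments torus : clear implicits.

Section Symbols.
Variable R : realType.
Local Notation C := R[i].

Definition Delta (V : zmodType) (a : int -> V) : int -> V :=
  fun k => a (k + 1) - a k.

Definition weight_function (Lambda : int -> R) (mu : R) : Prop :=
  [/\ forall k, 0 < Lambda k,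
      exists mu0 mu1 C0 C1 : R,
        [/\ 0 < mu0 /\ mu0 <= mu1, 0 < C0, 0 < C1, mu1 <= mu &
            forall k : int,
              C0 * (1 + `|k%:~R|) `^ mu0 <= Lambda k /\
              Lambda k <= C1 * (1 + `|k%:~R|) `^ mu1] &
      forall alpha gamma : nat, (gamma <= 1)%N -> exists2 B : R, 0 < B &
        forall k : int,
          `|k%:~R ^+ gamma * iter (alpha + gamma) (@Delta R) Lambda k| <=
          B * Lambda k `^ (1 - alpha%:R / mu)].

(* Functions on the torus are 2 pi-periodic functions on R. *)
Definition symbol_class (rho : R) (Lambda : int -> R) (m : R)
    (sigma : int -> R -> C) : Prop :=
  [/\ forall k x, sigma k (x + 2 * pi) = sigma k x,
      forall k, csmooth (sigma k) &
      forall alpha beta gamma : nat, (gamma <= 1)%N -> exists2 B : R, 0 < B &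
        forall (k : int) (x : R),
          cabs (iter alpha (@Delta C)
                  (fun j => cderiv beta
                     (fun y => j%:~R ^+ gamma *
                               iter gamma (@Delta C) (sigma ^~ y) j) x) k) <=
          B * Lambda k `^ (m - rho * alpha%:R)].

End Symbols.

Section Operators.
Variable R : realType.
Local Notation C := R[i].
Implicit Types (f g : int -> C) (A K : (int -> C) -> int -> C).
Local Open Scope ereal_scope.

Definition l2norm f : \bar R :=
  sqrte (\esum_(k in [set: int]) ((cabs (f k)) ^+ 2)%:E).

Definition l2 : set (int -> C) := [set f | l2norm f < +oo].

Definition linear_on_l2 A : Prop :=
  forall (a : C) f g, l2 f -> l2 g ->
    A (a \*o f \+ g)%R = (a \*o A f \+ A g)%R.

(* Bounded sequences are mapped to sequences with a convergent subsequence. *)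
Definition compact_operator K : Prop :=
  [/\ forall f, l2 f -> l2 (K f),
      linear_on_l2 K &
      forall u : nat -> int -> C,
        (exists M : R, forall n, l2norm (u n) <= M%:E) ->
        exists (phi : nat -> nat) (g : int -> C),
          [/\ {homo phi : i j / (i < j)%N}, l2 g &
              l2norm (K (u (phi n)) \- g)%R @[n --> \oo] --> 0]].

(* Extended-real valued: +oo exactly when A is not bounded on l2. *)
Definition opnorm A : \bar R :=
  ereal_sup [set l2norm (A f) | f in [set f | l2norm f <= 1]].

(* The sum over -N <= l <= N of f(l) e^{-ilx}. *)
Definition fourier_partial f (N : nat) (x : R) : C :=
  (\sum_(j < (2 * N).+1)
     let l : int := j%:Z - N%:Z in f l * expi (- (l%:~R * x)))%R.

(* For f in l2 the sum defining the Fourier transform is taken in L^2(-pi, pi). *)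
Definition is_fourier f (h : R -> C) : Prop :=
  cmeasurable (torus R) h /\
  \int[lebesgue_measure]_(x in torus R)
     ((cabs (h x - fourier_partial f N x)) ^+ 2)%:E @[N --> \oo] --> 0.

(* The choice of h is immaterial: by Riesz-Fischer, h exists for every f in l2
   and is unique almost everywhere. *)
Definition fourier f : R -> C := xget (fun=> 0%R) [set h | is_fourier f h].

Definition pdo (sigma : int -> R -> C) f : int -> C := fun k =>
  (((2 * pi)^-1)%:C *
   cintegral (fun x => expi (k%:~R * x) * sigma k x * fourier f x))%R.

Definition symbol_limsup (sigma : int -> R -> C) : \bar R :=
  ereal_inf [set
    ereal_sup [set ereal_sup [set (cabs (sigma k x))%:E | x in torus R]
              | k in [set k : int | (N <= `|k|)%N]]
  | N in [set: nat]].

End Operators.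

(* Main.v *)
Require Import Defs.
From mathcomp Require Import measurable_realfun ring lra zify.

(** Far out in the index k the symbol hardly depends on k: the estimates of the
symbol class with one difference in k give
|sigma(k + 1, x) - sigma(k, x)| <= B Lambda(k)^(- rho), and Lambda(k) grows at
least like a positive power of |k|.  So on a window k0 <= k < k0 + L of fixed
length L far from the origin, T_sigma is nearly the convolution operator with
multiplier sigma(k0, .), which a wave packet of frequency x0 detects:
[packet k0 L x0] is the unit vector u equal to L^(-1/2) e^(i k x0) on the window
and to 0 elsewhere.  Exactly,
[[
  <T_sigma u, u> - sigma(k0, x0) = (2 pi L)^(-1) *
    int sum_(j, l < L) e^(i (j - l)(x - x0)) (sigma(k0 + j, x) - sigma(k0, x0)) dx.
]]
Replacing sigma(k0 + j, x) by sigma(k0, x) costs little by the above.  What is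
left is the mean of sigma(k0, x) - sigma(k0, x0) against the Fejer kernel
|D_L(x - x0)|^2 / (2 pi L), where D_L is the Dirichlet kernel.  As sigma(k0, .)
is bounded, periodic and Lipschitz uniformly in k0, it obeys
|sigma(k0, x) - sigma(k0, x0)| <= e + M (1 - cos (x - x0))
([symbol_oscillation]), while |D_L(y)|^2 (1 - cos y) <= 2 ([dirichlet_bound]).
Hence, for L large and then |k0| large, <T_sigma u, u> is within O(e) of
sigma(k0, x0), uniformly in x0 ([packet_pdo_estimate]).

A compact operator does not see packets that move to infinity: along a
subsequence K u_n converges to some g in l2, and
|<K u_n, u_n>| <= ||K u_n - g|| + |<g, u_n>|, where the last term tends to 0
since g vanishes at infinity ([compact_packet_coef]).

If the limsup exceeded ||T_sigma - K|| by some e > 0, packets with |k0|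
arbitrarily large and |sigma(k0, x0)| > ||T_sigma - K|| + e would therefore contradict
|<(T_sigma - K) u, u>| <= ||T_sigma - K||. *)

Local Open Scope classical_set_scope.
Local Open Scope ring_scope.
Local Open Scope complex_scope.

(** * Modulus and complex exponentials *)

Section Modulus.
Variable R : realType.
Local Notation C := R[i].
Implicit Types z w : C.

Lemma cabsE z : cabs z = Num.sqrt (complex.Re z ^+ 2 + complex.Im z ^+ 2).
Proof. by case: z. Qed.

Lemma cabs_ge0 z : 0 <= cabs z.
Proof. by rewrite cabsE sqrtr_ge0. Qed.

Lemma cabs_sqr z : cabs z ^+ 2 = complex.Re z ^+ 2 + complex.Im z ^+ 2.
Proof. by rewrite cabsE sqr_sqrtr// addr_ge0 ?sqr_ge0. Qed.

Lemma cabsD z w : cabs (z + w) <= cabs z + cabs w.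
Proof. exact: le_normcD. Qed.

Lemma cabsM z w : cabs (z * w) = cabs z * cabs w.
Proof. exact: ComplexField.Normc.normcM. Qed.

Lemma cabsN z : cabs (- z) = cabs z.
Proof. exact: normcN. Qed.

Lemma cabs0 : cabs (0 : C) = 0.
Proof. exact: ComplexField.Normc.normc0. Qed.

Lemma cabs_eq0 z : cabs z = 0 -> z = 0.
Proof. exact: ComplexField.Normc.eq0_normc. Qed.

Lemma cabsB z w : cabs (z - w) <= cabs z + cabs w.
Proof. by rewrite -(cabsN w) cabsD. Qed.

Lemma cabs_sum (I : Type) (r : seq I) (P : pred I) (F : I -> C) :
  cabs (\sum_(i <- r | P i) F i) <= \sum_(i <- r | P i) cabs (F i).
Proof.
elim/big_ind2 : _ => [|x1 x2 y1 y2 h1 h2|//]; first by rewrite cabs0.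
by rewrite (le_trans (cabsD _ _))// lerD.
Qed.

Lemma cabs_real (x : R) : cabs x%:C = `|x|.
Proof. by rewrite cabsE /= expr0n addr0 sqrtr_sqr. Qed.

Lemma Re_le_cabs z : `|complex.Re z| <= cabs z.
Proof. by rewrite cabsE -sqrtr_sqr ler_wsqrtr// lerDl sqr_ge0. Qed.

Lemma Im_le_cabs z : `|complex.Im z| <= cabs z.
Proof. by rewrite cabsE -sqrtr_sqr ler_wsqrtr// lerDr sqr_ge0. Qed.

Lemma cabs_le_ReIm z : cabs z <= `|complex.Re z| + `|complex.Im z|.
Proof.
rewrite -(@ler_pXn2r _ 2%N)// ?nnegrE ?cabs_ge0 ?addr_ge0//.
rewrite cabs_sqr sqrrD !real_normK ?num_real// lerD2r lerDl.
by rewrite mulrn_wge0// mulr_ge0.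
Qed.

Lemma expiD (s t : R) : expi (s + t) = expi s * expi t.
Proof. by rewrite /expi cosD sinD; simpc; congr (_ +i* _); rewrite addrC. Qed.

Lemma expi0 : expi 0 = 1 :> C.
Proof. by rewrite /expi cos0 sin0. Qed.

Lemma cabs_expi (t : R) : cabs (expi t) = 1.
Proof. by rewrite cabsE /= cos2Dsin2 sqrtr1. Qed.

Lemma expiMn (n : nat) (t : R) : expi (n%:R * t) = expi t ^+ n.
Proof.
elim: n => [|n IH]; first by rewrite mul0r expi0.
by rewrite exprS -IH -expiD -natr1 mulrDl mul1r addrC.
Qed.

Lemma expi_conj (t : R) : expi (- t) = (expi t)^*%C.
Proof. by rewrite /expi cosN sinN. Qed.

Lemma mul_conjc z : z * z^*%C = (cabs z ^+ 2)%:C.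
Proof. by rewrite cabs_sqr; case: z => a b; simpc;
  rewrite [b * a]mulrC addNr /= !expr2. Qed.

Lemma ReD z w : complex.Re (z + w) = complex.Re z + complex.Re w.
Proof. by case: z; case: w. Qed.
Lemma ImD z w : complex.Im (z + w) = complex.Im z + complex.Im w.
Proof. by case: z; case: w. Qed.
Lemma ReM z w : complex.Re (z * w) =
  complex.Re z * complex.Re w - complex.Im z * complex.Im w.
Proof. by case: z; case: w. Qed.
Lemma ImM z w : complex.Im (z * w) =
  complex.Re z * complex.Im w + complex.Im z * complex.Re w.
Proof. by case: z => a b; case: w => c d. Qed.

End Modulus.

(** * Integration of continuous complex functions over the torus *)

Section Integral.
Variable R : realType.
Local Notation C := R[i].
Local Notation mu := (@lebesgue_measure R).
Implicit Types F G : R -> C.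

Definition ccontinuous F := continuous (cre F) /\ continuous (cim F).

Lemma ccontinuous_cst (c : C) : ccontinuous (fun=> c).
Proof. by split=> x; exact: cst_continuous. Qed.

Lemma ccontinuousD F G : ccontinuous F -> ccontinuous G ->
  ccontinuous (fun x => F x + G x).
Proof.
move=> [F1 F2] [G1 G2]; split=> x.
- rewrite (_ : cre _ = cre F \+ cre G); last by apply/funext => y;
    rewrite /cre /= ReD.
  by apply: continuousD; [exact: F1|exact: G1].
- rewrite (_ : cim _ = cim F \+ cim G); last by apply/funext => y;
    rewrite /cim /= ImD.
  by apply: continuousD; [exact: F2|exact: G2].
Qed.

Lemma ccontinuousM F G : ccontinuous F -> ccontinuous G ->
  ccontinuous (fun x => F x * G x).
Proof.
move=> [F1 F2] [G1 G2]; split=> x.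
- rewrite (_ : cre _ = cre F \* cre G \- cim F \* cim G); last first.
    by apply/funext => y; rewrite /cre /= ReM.
  by apply: continuousB; apply: continuousM;
    [exact: F1|exact: G1|exact: F2|exact: G2].
- rewrite (_ : cim _ = cre F \* cim G \+ cim F \* cre G); last first.
    by apply/funext => y; rewrite /cim /= ImM.
  by apply: continuousD; apply: continuousM;
    [exact: F1|exact: G2|exact: F2|exact: G1].
Qed.

Lemma ccontinuous_sum (I : Type) (r : seq I) (P : pred I) (F : I -> R -> C) :
  (forall i, ccontinuous (F i)) -> ccontinuous (fun x => \sum_(i <- r | P i) F i x).
Proof.
move=> cF; elim: r => [|a r IH].
  by under eq_fun do rewrite big_nil; exact: ccontinuous_cst.
under eq_fun do rewrite big_cons.
by case: (P a) => //; exact: ccontinuousD.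
Qed.

Lemma ccontinuous_expi (a b : R) : ccontinuous (fun x => expi (a * x + b)).
Proof.
have c x : {for x, continuous (fun x : R => a * x + b)}.
  by apply: continuousD; [apply: continuousM => //;
    exact: cst_continuous|exact: cst_continuous].
split=> x.
- by apply: (@continuous_comp _ _ _ (fun x : R => a * x + b) (@cos R));
    [exact: c|exact: continuous_cos].
- by apply: (@continuous_comp _ _ _ (fun x : R => a * x + b) (@sin R));
    [exact: c|exact: continuous_sin].
Qed.

Lemma csmooth_ccontinuous F : csmooth F -> ccontinuous F.
Proof.
move=> sF; split=> x; have [d1 d2] := sF 0%N x.
- exact/differentiable_continuous/derivable1_diffP.
- exact/differentiable_continuous/derivable1_diffP.
Qed.

Lemma torus_measurable : measurable (torus R).
Proof. exact: measurable_itv. Qed.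

Lemma continuous_integrable (f : R -> R) : continuous f ->
  mu.-integrable (torus R) (EFin \o f).
Proof.
move=> cf; apply: continuous_compact_integrable; first exact: segment_compact.
exact: continuous_subspaceT.
Qed.

Lemma lebesgue_torus : fine (mu (torus R)) = 2 * pi.
Proof.
rewrite /torus lebesgue_measure_itv /= lte_fin.
have := @pi_gt0 R => p0.
by rewrite ifT/=; lra.
Qed.

Lemma cintegralD F G : ccontinuous F -> ccontinuous G ->
  cintegral (fun x => F x + G x) = cintegral F + cintegral G.
Proof.
move=> [F1 F2] [G1 G2]; rewrite /cintegral; simpc.
congr (_ +i* _).
- rewrite -RintegralD//; try exact: continuous_integrable;
    last exact: torus_measurable.
  by apply: eq_Rintegral => x _; rewrite /cre ReD.
- rewrite -RintegralD//; try exact: continuous_integrable;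
    last exact: torus_measurable.
  by apply: eq_Rintegral => x _; rewrite /cim ImD.
Qed.

Lemma cintegralZ (c : C) F : ccontinuous F ->
  cintegral (fun x => c * F x) = c * cintegral F.
Proof.
move=> [F1 F2]; rewrite /cintegral; case: c => a b; simpc.
have mt := torus_measurable.
have i (f : R -> R) (r : R) : continuous f ->
  mu.-integrable (torus R) (EFin \o (fun x => r * f x)).
  move=> cf; apply: continuous_integrable => x.
  by apply: continuousM; [exact: cst_continuous|exact: cf].
congr (_ +i* _).
- rewrite -!RintegralZl//; try exact: continuous_integrable.
  rewrite -RintegralB//; try exact: i.
  by apply: eq_Rintegral => x _; rewrite /cre ReM.
- rewrite -!RintegralZl//; try exact: continuous_integrable.
  rewrite -RintegralD//; try exact: i.
  by apply: eq_Rintegral => x _; rewrite /cim ImM.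
Qed.

Lemma cintegral_sum (I : Type) (r : seq I) (F : I -> R -> C) :
  (forall i, ccontinuous (F i)) ->
  cintegral (fun x => \sum_(i <- r) F i x) = \sum_(i <- r) cintegral (F i).
Proof.
move=> cF; elim: r => [|a r IH].
  rewrite big_nil; under eq_fun do rewrite big_nil.
  by rewrite /cintegral /cre /cim /= !Rintegral_cst ?mul0r//;
    exact: torus_measurable.
under eq_fun do rewrite big_cons.
rewrite big_cons cintegralD// ?IH//; exact: ccontinuous_sum.
Qed.

Lemma cintegral_cst (c : C) : cintegral (fun=> c) = (2 * pi)%:C * c.
Proof.
rewrite /cintegral /cre /cim /= !Rintegral_cst ?lebesgue_torus;
  try exact: torus_measurable.
by case: c => a b; simpc; rewrite /= [a * _]mulrC [b * _]mulrC.
Qed.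

(** The factor 2 is the price of estimating real and imaginary parts separately;
the bound serves only for error terms. *)
Lemma cabs_cintegral_le F (G : R -> R) : ccontinuous F -> continuous G ->
  (forall x, x \in torus R -> cabs (F x) <= G x) ->
  cabs (cintegral F) <= 2 * \int[mu]_(x in torus R) G x.
Proof.
move=> [F1 F2] cG FG; have mt := torus_measurable.
apply: (le_trans (cabs_le_ReIm _)); rewrite /= mulr_natl mulr2n.
have cabsf (f : R -> R) : continuous f ->
  mu.-integrable (torus R) (EFin \o (fun x => `|f x|)).
  move=> cf; apply: continuous_integrable => x.
  apply: (@continuous_comp _ _ _ f Num.norm); first exact: cf.
  exact: norm_continuous.
apply: lerD.
- apply: le_trans (le_normr_Rintegral _ _) _ => //;
    first exact: continuous_integrable.
  apply: le_Rintegral => //; [exact: cabsf|exact: continuous_integrable|].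
  by move=> x tx; rewrite (le_trans (Re_le_cabs _))// FG// inE.
- apply: le_trans (le_normr_Rintegral _ _) _ => //;
    first exact: continuous_integrable.
  apply: le_Rintegral => //; [exact: cabsf|exact: continuous_integrable|].
  by move=> x tx; rewrite (le_trans (Im_le_cabs _))// FG// inE.
Qed.

Lemma sin_intpi (m : int) : sin (m%:~R * pi) = 0 :> R.
Proof.
have h (n : nat) : sin (n%:R * pi) = 0 :> R.
  elim: n => [|n IH]; first by rewrite mul0r sin0.
  by rewrite -natr1 mulrDl mul1r sinDpi IH oppr0.
case: m => n; first by rewrite -pmulrn h.
by rewrite NegzE mulrNz mulNr sinN -pmulrn h oppr0.
Qed.

Lemma cintegral_expi (m : int) : m != 0 ->
  cintegral (fun x => expi (m%:~R * x)) = 0 :> C.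
Proof.
move=> m0; have m0' : m%:~R != 0 :> R by rewrite intr_eq0.
have p0 : - pi < pi :> R by rewrite gtrN// pi_gt0.
have cl x : {for x, continuous (fun x : R => m%:~R * x)}.
  by apply: continuousM => //; exact: cst_continuous.
have ccos : continuous (fun x : R => cos (m%:~R * x)).
  by move=> x; apply: (@continuous_comp _ _ _ (fun x : R => m%:~R * x) (@cos R));
    [exact: cl|exact: continuous_cos].
have csin : continuous (fun x : R => sin (m%:~R * x)).
  by move=> x; apply: (@continuous_comp _ _ _ (fun x : R => m%:~R * x) (@sin R));
    [exact: cl|exact: continuous_sin].
have FTC (f F : R -> R) : continuous f -> (forall x : R, is_derive x 1 F (f x)) ->
    \int[mu]_(x in torus R) f x = F pi - F (- pi).
  move=> cf dF.
  have cF : continuous F.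
    by move=> x; apply: differentiable_continuous; apply/derivable1_diffP;
      exact: ex_derive.
  rewrite /Rintegral /torus (@continuous_FTC2 _ f F)//.
  - exact: continuous_subspaceT.
  - split.
    + by move=> x _; exact: ex_derive.
    + exact: cvg_at_right_filter (cF _).
    + exact: cvg_at_left_filter (cF _).
  - by move=> x _; rewrite derive1E derive_val.
have Dsin (x : R) : is_derive x 1 (fun x =>
  sin (m%:~R * x) / m%:~R) (cos (m%:~R * x)).
  apply: is_derive_eq; rewrite !scaler0 ?addr0 ?add0r.
  by rewrite /GRing.scale /=; field.
have Dcos (x : R) : is_derive x 1 (fun x =>
  - cos (m%:~R * x) / m%:~R) (sin (m%:~R * x)).
  apply: is_derive_eq; rewrite !scaler0 ?addr0 ?add0r.
  by rewrite /GRing.scale /=; field.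
rewrite /cintegral /cre /cim /=; congr (_ +i* _).
- by rewrite (FTC _ _ ccos Dsin) mulrN sinN sin_intpi oppr0 !mul0r subrr.
- by rewrite (FTC _ _ csin Dcos) mulrN cosN subrr.
Qed.

End Integral.

(** * The operator on finitely supported sequences *)

Section Fourier.
Variable R : realType.
Local Notation C := R[i].
Local Notation mu := (@lebesgue_measure R).
Implicit Types (f : int -> C) (h : R -> C).

Definition supported_on (k0 : int) (L : nat) f :=
  forall k : int, ~~ (k0 <= k < k0 + L%:Z) -> f k = 0.

(** The Fourier transform of a sequence supported on the window. *)
Definition trig_poly (k0 : int) (L : nat) f (x : R) : C :=
  \sum_(j < L) f (k0 + j%:Z) * expi (- ((k0 + j%:Z)%:~R * x)).

Lemma centered_sum_window (k0 : int) (L N : nat) (F : int -> C) :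
  supported_on k0 L F -> (absz k0 + L <= N)%N ->
  \sum_(j < (2 * N).+1) F (j%:Z - N%:Z) = \sum_(j < L) F (k0 + j%:Z).
Proof.
move=> F0 leN.
have [m Em] : exists m : nat, k0 + N%:Z = m%:Z by exists (absz (k0 + N%:Z)); lia.
have le1 : (m <= m + L)%N by lia.
have le2 : (m + L <= (2 * N).+1)%N by lia.
rewrite -(big_mkord xpredT (fun j => F (j%:Z - N%:Z))).
rewrite (@big_cat_nat _ _ _ (m + L)%N)//= (@big_cat_nat _ _ _ m)//=.
rewrite big_nat_cond big1 => [|j]; last by move=> Hj; apply: F0; lia.
rewrite [X in _ + X]big_nat_cond [X in _ + X]big1 => [|j]; last first.
  by move=> Hj; apply: F0; lia.
rewrite add0r addr0 -{1}[m]add0n big_addn addKn big_mkord.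
by apply: eq_bigr => j _; congr F; lia.
Qed.

Lemma ccontinuous_trig_poly k0 L f : ccontinuous (trig_poly k0 L f).
Proof.
apply: ccontinuous_sum => j; apply: ccontinuousM; first exact: ccontinuous_cst.
by under eq_fun do rewrite -mulNr -[_ * _]addr0; exact: ccontinuous_expi.
Qed.

Lemma fourier_partial_window k0 L f N : supported_on k0 L f ->
  (absz k0 + L <= N)%N -> fourier_partial f N = trig_poly k0 L f.
Proof.
move=> f0 leN; apply/funext => x; rewrite /fourier_partial /trig_poly.
apply: (centered_sum_window (F := fun l => f l * expi (- (l%:~R * x)))) => //.
by move=> k /f0 ->; rewrite mul0r.
Qed.

Lemma ccontinuous_cmeasurable (D : set R) h : ccontinuous h -> measurable D ->
  cmeasurable D h.
Proof.
move=> [h1 h2] mD; split.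
- by apply: measurable_funTS; apply: continuous_measurable_fun.
- by apply: measurable_funTS; apply: continuous_measurable_fun.
Qed.

Lemma is_fourier_trig_poly k0 L f : supported_on k0 L f ->
  is_fourier f (trig_poly k0 L f).
Proof.
move=> f0; split.
  apply: ccontinuous_cmeasurable;
    [exact: ccontinuous_trig_poly|exact: torus_measurable].
apply: cvg_near_cst; exists (absz k0 + L)%N => // N /= leN.
rewrite (fourier_partial_window f0 leN); apply: integral0_eq => x _.
by rewrite subrr cabs0 expr0n.
Qed.

(** The Fourier transform is only specified up to a null set.  For a finitely
supported f the partial sums are eventually constant, so their distance to the
chosen representative, which tends to 0, is 0. *)
Lemma fourier_window_ae k0 L f : supported_on k0 L f ->
  cmeasurable (torus R) (fourier f) /\
  ae_eq mu (torus R) (fourier f) (trig_poly k0 L f).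
Proof.
move=> f0.
have /(xgetPex (fun=> 0)) : [set h | is_fourier f h] !=set0.
  by exists (trig_poly k0 L f); exact: is_fourier_trig_poly.
rewrite -/(fourier f) => -[mf cvg0]; split=> //.
have [mp1 mp2] : cmeasurable (torus R) (trig_poly k0 L f).
  apply: ccontinuous_cmeasurable;
    [exact: ccontinuous_trig_poly|exact: torus_measurable].
case: (mf) => mf1 mf2.
set I := (\int[mu]_(x in torus R) ((cabs (fourier f x - trig_poly k0 L f x)) ^+ 2)%:E)%E.
have I0 : I = 0%E.
  apply: esym; apply: (cvg_unique (@ereal_hausdorff R) cvg0).
  apply: cvg_near_cst; exists (absz k0 + L)%N => // N /= leN.
  by rewrite (fourier_partial_window f0 leN).
have mt := @torus_measurable R.
have : (\int[mu]_(x in torus R) `|((cabs (fourier f x - trig_poly k0 L f x)) ^+ 2)%:E| = 0)%E.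
  rewrite -I0; apply: eq_integral => x _; rewrite gee0_abs// lee_fin.
  by rewrite exprn_ge0// cabs_ge0.
have m2 : measurable_fun (torus R) (fun x =>
  ((cabs (fourier f x - trig_poly k0 L f x)) ^+ 2)%:E).
  apply/measurable_EFinP.
  rewrite (_ : (fun x => _) = (fun x =>
    (cre (fourier f) x - cre (trig_poly k0 L f) x) ^+ 2 +
     (cim (fourier f) x - cim (trig_poly k0 L f) x) ^+ 2)); last first.
    apply/funext => x; rewrite cabs_sqr /cre /cim.
    by case: (fourier f x) => a b; case: (trig_poly _ _ _ x).
  by apply: measurable_funD; apply: measurable_funX; apply: measurable_funB.
move/(ae_eq_integral_abs mu mt m2).1; apply: filterS => x /[apply] /eqP.
rewrite /cst eqe sqrf_eq0 => /eqP/cabs_eq0/eqP.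
by rewrite subr_eq0 => /eqP.
Qed.

Lemma cintegral_ae (F G : R -> C) : cmeasurable (torus R) F ->
  cmeasurable (torus R) G ->
  ae_eq mu (torus R) F G -> cintegral F = cintegral G.
Proof.
move=> [F1 F2] [G1 G2] FG; have mt := @torus_measurable R.
rewrite /cintegral; congr (_ +i* _); congr fine; apply: ae_eq_integral => //.
- exact/measurable_EFinP.
- exact/measurable_EFinP.
- by apply: filterS FG => x /[apply]; rewrite /cre => ->.
- exact/measurable_EFinP.
- exact/measurable_EFinP.
- by apply: filterS FG => x /[apply]; rewrite /cim => ->.
Qed.

Lemma cmeasurableM (D : set R) (F G : R -> C) : cmeasurable D F ->
  cmeasurable D G ->
  cmeasurable D (fun x => F x * G x).
Proof.
move=> [F1 F2] [G1 G2]; split.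
- rewrite (_ : cre _ = cre F \* cre G \- cim F \* cim G); last first.
    by apply/funext => y; rewrite /cre /= ReM.
  by apply: measurable_funB; apply: measurable_funM.
- rewrite (_ : cim _ = cre F \* cim G \+ cim F \* cre G); last first.
    by apply/funext => y; rewrite /cim /= ImM.
  by apply: measurable_funD; apply: measurable_funM.
Qed.

(** This is the matrix of T_sigma: the entry (k, l) is a Fourier coefficient of
sigma(k, .). *)
Lemma pdo_window (sigma : int -> R -> C) k0 L f k :
  supported_on k0 L f -> ccontinuous (sigma k) ->
  pdo sigma f k = ((2 * pi)^-1)%:C * \sum_(j < L) f (k0 + j%:Z) *
     cintegral (fun x => expi ((k - (k0 + j%:Z))%:~R * x) * sigma k x).
Proof.
move=> f0 cs; rewrite /pdo; congr (_ * _).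
have mt := @torus_measurable R.
have [mf ae] := fourier_window_ae f0.
have ce (a : R) : ccontinuous (fun x => expi (a * x)).
  by under eq_fun do rewrite -[_ * _]addr0; exact: ccontinuous_expi.
have cE : ccontinuous (fun x => expi (k%:~R * x) * sigma k x)
  by exact: ccontinuousM.
transitivity (cintegral (fun x =>
  expi (k%:~R * x) * sigma k x * trig_poly k0 L f x)).
  apply: cintegral_ae.
  - by apply: cmeasurableM => //; exact: ccontinuous_cmeasurable.
  - apply: ccontinuous_cmeasurable => //; apply: ccontinuousM => //.
    exact: ccontinuous_trig_poly.
  - by apply: filterS ae => x /[apply] ->.
transitivity (cintegral (fun x => \sum_(j < L) f (k0 + j%:Z) *
    (expi ((k - (k0 + j%:Z))%:~R * x) * sigma k x))).
  congr cintegral; apply/funext => x; rewrite mulr_sumr; apply: eq_bigr => j _.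
  rewrite intrB mulrBl expiD; ring.
rewrite cintegral_sum => [|j]; last first.
  by apply: ccontinuousM; [exact: ccontinuous_cst|exact: ccontinuousM].
by apply: eq_bigr => j _; rewrite cintegralZ//; exact: ccontinuousM.
Qed.

End Fourier.

(** * Square-summable sequences *)

Section L2.
Variable R : realType.
Local Notation C := R[i].
Implicit Types (f g : int -> C).

Definition window (k0 : int) (L : nat) : set int := [set k0 + j%:Z | j in `I_L].

Lemma finite_window k0 L : finite_set (window k0 L).
Proof. exact/finite_image/finite_II. Qed.

Lemma fsum_window k0 L (a : int -> \bar R) :
  (\sum_(k \in window k0 L) a k = \sum_(j < L) a (k0 + j%:Z)%R)%E.
Proof.
rewrite fsbig_image => [|i j _ _ h]; last by lia.
by rewrite -(fsbig_ord _ _ (fun j : nat => a (k0 + j%:Z))).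
Qed.

Lemma esum_window_ge k0 L (a : int -> \bar R) :
  (\sum_(j < L) a (k0 + j%:Z)%R <= \esum_(k in [set: int]) a k)%E.
Proof.
rewrite -fsum_window; apply: esum_ge; exists (window k0 L) => //.
by split; first exact: finite_window.
Qed.

Lemma esum_supported k0 L (a : int -> \bar R) : (forall k, 0 <= a k)%E ->
  (forall k : int, ~~ (k0 <= k < k0 + L%:Z) -> a k = 0%E) ->
  (\esum_(k in [set: int]) a k = \sum_(j < L) a (k0 + j%:Z)%R)%E.
Proof.
move=> a0 s0; rewrite -fsum_window -esum_fset//; last exact: finite_window.
rewrite [RHS]esum_mkcond; apply: eq_esum => k _.
case: ifPn => // /negP kW; apply: s0; apply/negP => kW'; apply: kW; apply: mem_set.
by exists (absz (k - k0)) => /=; lia.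
Qed.

Lemma l2norm_le f (r : R) : 0 <= r ->
  (l2norm f <= r%:E)%E =
  (\esum_(k in [set: int]) ((cabs (f k)) ^+ 2)%:E <= (r ^+ 2)%:E)%E.
Proof.
move=> r0; rewrite -[in LHS](ger0_norm r0) -sqrtr_sqr -[_%:E]/(sqrte (r ^+ 2)%:E).
by rewrite lee_sqrt// lee_fin sqr_ge0.
Qed.

Lemma sum_window_le f (r : R) k0 L : 0 <= r -> (l2norm f <= r%:E)%E ->
  \sum_(j < L) (cabs (f (k0 + j%:Z))) ^+ 2 <= r ^+ 2.
Proof.
move=> r0; rewrite l2norm_le// => h; rewrite -lee_fin (le_trans _ h)// -sumEFin.
exact: (@esum_window_ge k0 L (fun k => (cabs (f k) ^+ 2)%:E)).
Qed.

Lemma cabs_le_l2norm f (r : R) k : 0 <= r -> (l2norm f <= r%:E)%E ->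
  cabs (f k) <= r.
Proof.
move=> r0 h; have := @sum_window_le f r k 1 r0 h.
by rewrite big_ord1 addr0 ler_pXn2r// nnegrE cabs_ge0.
Qed.

(** Once a finite set carries all but e^2 of the squared norm, every entry outside
it is smaller than e. *)
Lemma l2_vanishing g (e : R) : l2 g -> 0 < e ->
  exists N : nat, forall k : int, (N <= absz k)%N -> cabs (g k) < e.
Proof.
move=> gl2 e0; pose a k : \bar R := ((cabs (g k)) ^+ 2)%:E.
have a0 k : (0 <= a k)%E by rewrite lee_fin sqr_ge0.
have Sfin : \esum_(k in [set: int]) a k \is a fin_num.
  rewrite -sqrte_fin_num ?esum_ge0// fin_numElt; apply/andP; split=> //.
  by rewrite (lt_le_trans _ (sqrte_ge0 _)).
have e20 : 0 < e ^+ 2 by rewrite exprn_gt0.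
have [_ [X [finX _] <-] hX] := ub_ereal_sup_adherent e20 Sfin.
have /finite_seqP[A XA] := finX.
exists (\max_(k <- A) absz k).+1 => k hk.
have kX : ~ X k.
  rewrite XA /= => kA; have := @leq_bigmax_seq _ A xpredT absz k kA isT.
  by move=> h; move: (leq_trans hk h); rewrite ltnn.
have : (\sum_(i \in X `|` [set k]) a i <= \esum_(k in [set: int]) a k)%E.
  by apply: ereal_sup_ubound; exists (X `|` [set k]) => //; split=> //;
    rewrite finite_setU.
rewrite fsbigU0//; last by move=> x [Xx xk]; apply: kX; rewrite -xk.
rewrite fsbig_set1 => hS.
suff : cabs (g k) ^+ 2 < e ^+ 2 by rewrite ltr_pXn2r// nnegrE ?cabs_ge0// ltW.
move: hX hS; rewrite -/(esum _ _).
have -> : (\sum_(i \in X) a i = (\sum_(i \in X) (cabs (g i)) ^+ 2)%:E)%E.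
  by rewrite !fsbig_finite// sumEFin.
rewrite -(fineK Sfin) -EFinD lte_fin lee_fin; lra.
Qed.

Lemma l2norm_cvg0 (v : nat -> int -> C) (e : R) :
  (l2norm (v n) @[n --> \oo] --> 0)%E -> 0 < e ->
  exists N : nat, forall n, (N <= n)%N -> (l2norm (v n) <= e%:E)%E.
Proof.
move=> cv e0; have : \forall n \near \oo, (l2norm (v n) < e%:E)%E.
  have nb : nbhs (0%E : \bar R) [set y | (y < e%:E)%E].
    by apply: open_nbhs_nbhs; split;
      [exact: open_ereal_lt_ereal|rewrite /= lte_fin].
  exact: (cv _ nb).
by case=> N _ h; exists N => n /h /ltW.
Qed.

(** Cauchy-Schwarz against the constant vector L.+1^(-1/2), read off from the
nonnegativity of the variance of a. *)
Lemma sum_le_sqrt_card (L : nat) (a : 'I_L.+1 -> R) (r : R) : 0 <= r ->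
  \sum_j a j ^+ 2 <= r ^+ 2 -> (Num.sqrt L.+1%:R)^-1 * \sum_j a j <= r.
Proof.
move=> r0 h; set s := Num.sqrt _.
have Ln0 : (0 : R) < L.+1%:R by rewrite ltr0n.
have s0 : 0 < s by rewrite sqrtr_gt0.
have s2 : s ^+ 2 = L.+1%:R by rewrite sqr_sqrtr// ltW.
set S := \sum_j a j; pose m := S / L.+1%:R.
have : 0 <= \sum_j (a j - m) ^+ 2 by apply: sumr_ge0 => j _; exact: sqr_ge0.
under eq_bigr do rewrite sqrrB.
rewrite big_split sumrB /= sumr_const card_ord sumrMnl -mulr_suml -/S => h2.
have : (s^-1 * S) ^+ 2 <= r ^+ 2.
  apply: le_trans h; rewrite exprMn exprVn s2.
  suff -> : L.+1%:R^-1 * S ^+ 2 =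
    \sum_j a j ^+ 2 - (\sum_j a j ^+ 2 - S * m *+ 2 + m ^+ 2 *+ L.+1).
    by rewrite gerBl.
  by rewrite /m -[_ *+ L.+1]mulr_natr; field; rewrite lt0r_neq0.
have [neg _|nneg] := ltP (s^-1 * S) 0; first by rewrite (le_trans (ltW neg)).
by rewrite ler_pXn2r// nnegrE.
Qed.

End L2.

(** * Uniform estimates on the symbol *)

Section Symbol.
Variable R : realType.
Local Notation C := R[i].
Variables (Lambda : int -> R) (mu rho : R) (sigma : int -> R -> C).
Hypothesis hLambda : weight_function Lambda mu.
Hypothesis rho_gt0 : 0 < rho.
Hypothesis hsigma : symbol_class rho Lambda 0 sigma.

Local Arguments cderiv : simpl never.
Local Arguments cabs : simpl never.

Lemma cderiv0 (f : R -> C) : cderiv 0 f = f.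
Proof. by apply/funext => x; rewrite /cderiv /cre /cim /=; case: (f x). Qed.

Lemma symbol_ccontinuous k : ccontinuous (sigma k).
Proof. by case: hsigma => _ h _; exact: csmooth_ccontinuous. Qed.

Lemma symbol_bounded : exists2 B : R, 0 < B & forall k x, cabs (sigma k x) <= B.
Proof.
case: hsigma => _ _ /(_ 0%N 0%N 0%N isT)[B B0 h]; exists B => // k x.
have := h k x; rewrite mulr0 subr0 powRr0 mulr1 /= cderiv0.
by rewrite expr0 mul1r.
Qed.

Lemma symbol_deriv_bounded : exists2 B : R, 0 < B & forall k x,
  cabs (cderiv 1 (sigma k) x) <= B.
Proof.
case: hsigma => _ _ /(_ 0%N 1%N 0%N isT)[B B0 h]; exists B => // k x.
have := h k x; rewrite mulr0 subr0 powRr0 mulr1 /=.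
by under eq_fun do rewrite expr0 mul1r.
Qed.

(** The mean value theorem holds for real and imaginary parts, whence a constant
twice the bound on the derivative. *)
Lemma symbol_lipschitz : exists2 B : R, 0 < B & forall k x y,
  cabs (sigma k x - sigma k y) <= B * `|x - y|.
Proof.
have [B B0 hB] := symbol_deriv_bounded.
exists (B + B); first by rewrite addr_gt0.
move=> k.
have mean_value (u : R -> R) : (forall x, derivable u x 1) ->
  (forall x, `|derive1 u x| <= B) ->
    forall x y, `|u x - u y| <= B * `|x - y|.
  move=> du bu.
  have le x y : x <= y -> `|u y - u x| <= B * `|y - x|.
    move=> xy; have [|| c _ ->] := @MVT_segment R u (derive1 u) x y xy.
    - by move=> z _; split => //; rewrite derive1E.
    - apply: derivable_within_continuous => z _; exact: du.
    - by rewrite normrM ler_wpM2r.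
  move=> x y; have [|/ltW] := leP x y; last exact: le.
  by rewrite distrC (distrC x); exact: le.
have [_ sm _] := hsigma.
move=> x y; rewrite (le_trans (cabs_le_ReIm _))// mulrDl.
have -> z w : complex.Re (z - w) = complex.Re z - complex.Re w :> R by case: z;
  case: w.
have -> z w : complex.Im (z - w) = complex.Im z - complex.Im w :> R by case: z;
  case: w.
apply: lerD.
- apply: (mean_value (cre (sigma k))) => z; first by case: (sm k 0%N z).
  exact: le_trans (Re_le_cabs (cderiv 1 (sigma k) z)) (hB k z).
- apply: (mean_value (cim (sigma k))) => z; first by case: (sm k 0%N z).
  exact: le_trans (Im_le_cabs (cderiv 1 (sigma k) z)) (hB k z).
Qed.

(** Near the diagonal modulo 2 pi the Lipschitz bound gives the term e; away from
it 1 - cos (x - y) is bounded below and M absorbs the supremum of sigma.  The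
weight 1 - cos is chosen because it cancels the peak of the Dirichlet kernel. *)
Lemma symbol_oscillation (e : R) : 0 < e -> exists2 M : R, 0 <= M &
  forall k x y, x \in torus R -> y \in torus R ->
    cabs (sigma k x - sigma k y) <= e + M * (1 - cos (x - y)).
Proof.
move=> e0; have [B0 B00 b0] := symbol_bounded.
have [B1 B10 lip] := symbol_lipschitz.
have p0 := @pi_gt0 R.
pose d := Num.min (e / B1) pi.
have d0 : 0 < d by rewrite lt_min p0 divr_gt0.
have dpi : d <= pi by rewrite ge_min lexx orbT.
have B1d : B1 * d <= e by rewrite mulrC -ler_pdivlMr// ge_min lexx.
have cd1 : 0 < 1 - cos d.
  by rewrite subr_gt0 -(@cos0 R) ltr_cos // in_itv /= ?lexx ?dpi ?(ltW d0) ?(ltW p0).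
exists ((B0 + B0) / (1 - cos d)); first by rewrite divr_ge0// ltW// addr_gt0.
have half_period k x y : `|x - y| <= pi ->
    cabs (sigma k x - sigma k y) <= e + (B0 + B0) / (1 - cos d) * (1 - cos (x - y)).
  move=> xy; have [h|h] := leP `|x - y| d.
    rewrite (le_trans (lip _ _ _))// (le_trans (ler_wpM2l (ltW B10) h))//.
    rewrite (le_trans B1d)// lerDl mulr_ge0 ?subr_ge0 ?cos_le1//.
    by rewrite divr_ge0// ltW// addr_gt0.
  rewrite (le_trans (cabsB _ _))// (le_trans (lerD (b0 _ _) (b0 _ _)))//.
  rewrite -[X in X <= _]add0r; apply: lerD; first exact: ltW.
  rewrite mulrAC ler_pdivlMr//.
  rewrite ler_wpM2l ?addr_ge0 ?(ltW B00)// lerB// -cos_norm ltW// ltr_cos//.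
  - by rewrite in_itv /= (ltW d0).
  - by rewrite in_itv /= normr_ge0.
(* Two points of the torus further apart than pi are brought within pi by
   shifting one of them by a period. *)
have [per _ _] := hsigma.
move=> k x y; rewrite !inE /torus /= !in_itv /= => /andP[x1 x2] /andP[y1 y2].
have [h|h] := leP `|x - y| pi; first exact: half_period.
have [xy|xy] := leP 0 (x - y).
- rewrite ger0_norm// in h.
  have -> : cos (x - y) = cos (x - (y + 2 * pi)).
    by rewrite -(cosD2pi (x - (y + 2 * pi))) mulr_natl; congr cos; ring.
  by rewrite -(per k y); apply: half_period; rewrite ler_norml; lra.
- rewrite ltr0_norm// in h.
  have -> : cos (x - y) = cos (x + 2 * pi - y).
    by rewrite -(cosD2pi (x - y)) mulr_natl; congr cos; ring.
  by rewrite -(per k x); apply: half_period; rewrite ler_norml; lra.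
Qed.

Lemma weight_power_vanishing (e : R) : 0 < e ->
  exists N : nat, forall k : int, (N <= absz k)%N -> Lambda k `^ (- rho) <= e.
Proof.
move=> e0; case: hLambda => L0 [mu0 [mu1 [C0 [C1 [[mu00 _] C00 C10 _ hL]]]]] _.
(* Lambda k >= t is equivalent to Lambda k `^ (- rho) <= e, and s `^ mu0 = t / C0. *)
pose t := e `^ (- rho^-1); have t0 : 0 < t by rewrite powR_gt0.
pose s := (t / C0) `^ mu0^-1; have s0 : 0 < s by rewrite powR_gt0// divr_gt0.
exists (Num.truncn s).+1 => k hk.
have sk : s <= 1 + `|k%:~R|.
  have : s < (Num.truncn s).+1%:R by rewrite truncnS_gt.
  have : (Num.truncn s).+1%:R <= `|k%:~R| :> R.
    by rewrite -intr_norm -abszE -pmulrn ler_nat.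
  lra.
have tk : t <= Lambda k.
  apply: le_trans (hL k).1; rewrite mulrC -ler_pdivrMr//.
  have -> : t / C0 = s `^ mu0 by rewrite /s -powRrM mulVf ?gt_eqF// powRr1// divr_ge0// ltW.
  by rewrite ge0_ler_powR// ?nnegrE ltW// ltr_pwDl.
have -> : e = t `^ (- rho).
  by rewrite /t -powRrM mulrNN mulVf ?gt_eqF// powRr1// ltW.
rewrite !powRN lef_pV2 ?posrE ?powR_gt0//.
by rewrite ge0_ler_powR// ?nnegrE ltW.
Qed.

Lemma symbol_slow_step (e : R) : 0 < e -> exists N : nat,
  forall (k : int) x, (N <= absz k)%N -> cabs (sigma (k + 1) x - sigma k x) <= e.
Proof.
move=> e0; case: hsigma => _ _ /(_ 1%N 0%N 0%N isT)[B B0 h].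
have eB : 0 < e / B by rewrite divr_gt0.
have [N hN] := weight_power_vanishing eB; exists N => k x kN.
have := h k x; rewrite /= /Delta !cderiv0 !expr0 !mul1r mulr1 sub0r => /le_trans;
  apply.
by rewrite mulrC -ler_pdivlMr// hN.
Qed.

Lemma symbol_slow (e : R) (L : nat) : 0 < e -> exists N : nat,
  forall (k : int) x (j : nat), (N <= absz k)%N -> (j < L)%N ->
    cabs (sigma (k + j%:Z) x - sigma k x) <= e.
Proof.
move=> e0; have eL : 0 < e / L.+1%:R by rewrite divr_gt0.
have [N hN] := symbol_slow_step eL; exists (N + L)%N => k x j kN jL.
have step : forall i : nat, (i <= j)%N ->
    cabs (sigma (k + i%:Z) x - sigma k x) <= i%:R * (e / L.+1%:R).
  elim=> [_|i IH ij]; first by rewrite addr0 subrr cabs0 mul0r.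
  rewrite -natr1 mulrDl mul1r.
  have -> : sigma (k + i.+1%:Z) x - sigma k x =
     (sigma (k + i%:Z) x - sigma k x) + (sigma (k + i%:Z + 1) x - sigma (k
       + i%:Z) x).
    have -> : k + i.+1%:Z = k + i%:Z + 1 by lia.
    ring.
  apply: le_trans (cabsD _ _) _; apply: lerD; first exact: IH (ltnW ij).
  by apply: hN; lia.
apply: le_trans (step j (leqnn j)) _.
rewrite mulrA ler_pdivrMr// mulrC ler_wpM2l ?(ltW e0)// ler_nat; lia.
Qed.

End Symbol.

(** * Wave packets *)

Section WavePacket.
Variable R : realType.
Local Notation C := R[i].
Local Notation mu := (@lebesgue_measure R).

Definition dirichlet (L : nat) (y : R) : C := \sum_(j < L) expi (j%:R * y).

Lemma dirichlet_sqr L y :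
  \sum_(j < L) \sum_(l < L) expi ((j%:Z - l%:Z)%:~R * y) =
    (cabs (dirichlet L y) ^+ 2)%:C.
Proof.
rewrite -mul_conjc /dirichlet rmorph_sum mulr_suml; apply: eq_bigr => j _.
rewrite mulr_sumr; apply: eq_bigr => l _.
by rewrite intrB mulrBl expiD expi_conj.
Qed.

(** Since |e^(iy) - 1|^2 = 2 (1 - cos y), this is the geometric sum
(e^(iy) - 1) D_L(y) = e^(iLy) - 1, whose modulus is at most 2. *)
Lemma dirichlet_bound L y : (1 - cos y) * cabs (dirichlet L y) ^+ 2 <= 2 :> R.
Proof.
have e1 : cabs (expi y - 1) ^+ 2 = 2 * (1 - cos y) :> R.
  rewrite cabs_sqr /= subr0; have := cos2Dsin2 y; nra.
have e2 : (expi y - 1) * dirichlet L y = expi y ^+ L - 1 :> C.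
  rewrite subrX1; congr (_ * _); apply: eq_bigr => j _; exact: expiMn.
have : cabs (expi y ^+ L - 1) <= 2 :> R.
  rewrite (le_trans (cabsB _ _))// -expiMn cabs_expi -expi0 cabs_expi; lra.
rewrite -e2 cabsM => h.
have : (cabs (expi y - 1) * cabs (dirichlet L y)) ^+ 2 <= 2 ^+ 2 :> R.
  by rewrite ler_pXn2r// nnegrE ?mulr_ge0 ?cabs_ge0.
rewrite exprMn e1; lra.
Qed.

Lemma ccontinuous_expi_shift (a x0 : R) : ccontinuous (fun x =>
  expi (a * (x - x0)) : C).
Proof. by under eq_fun do rewrite mulrBr; exact: ccontinuous_expi. Qed.

Lemma cintegral_expi_shift (m : int) (x0 : R) :
  cintegral (fun x => expi (m%:~R * (x - x0))) =
    (if m == 0 then 2 * pi else 0)%:C :> C.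
Proof.
case: eqVneq => [->|m0].
  under eq_fun do rewrite mul0r expi0.
  by rewrite cintegral_cst mulr1.
under eq_fun do rewrite mulrBr expiD mulrC.
rewrite cintegralZ ?cintegral_expi ?mulr0//.
by under eq_fun do rewrite -[_ * _]addr0; exact: ccontinuous_expi.
Qed.

Definition packet (k0 : int) (L : nat) (x0 : R) : int -> C := fun k =>
  if k0 <= k < k0 + L%:Z then ((Num.sqrt L%:R)^-1)%:C * expi (k%:~R * x0) else 0.

Lemma packet_supported k0 L x0 : supported_on k0 L (packet k0 L x0).
Proof. by move=> k /negbTE kW; rewrite /packet kW. Qed.

Lemma packetE k0 L x0 (j : 'I_L) : packet k0 L x0 (k0 + j%:Z) =
  ((Num.sqrt L%:R)^-1)%:C * expi ((k0 + j%:Z)%:~R * x0).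
Proof. by rewrite /packet ifT//; have := ltn_ord j; lia. Qed.

Lemma conjc_packet k0 L x0 (j : 'I_L) : (packet k0 L x0 (k0 + j%:Z))^*%C =
  ((Num.sqrt L%:R)^-1)%:C * expi (- ((k0 + j%:Z)%:~R * x0)).
Proof. by rewrite packetE expi_conj /expi; simpc. Qed.

Lemma cabs_packet k0 L x0 (j : 'I_L) :
  cabs (packet k0 L x0 (k0 + j%:Z)) = (Num.sqrt L%:R)^-1.
Proof.
by rewrite packetE cabsM cabs_expi mulr1 cabs_real ger0_norm// invr_ge0 sqrtr_ge0.
Qed.

Lemma l2norm_packet k0 L x0 : (l2norm (packet k0 L.+1 x0) <= 1)%E.
Proof.
rewrite l2norm_le// (@esum_supported _ k0 L.+1); last 2 first.
- by move=> k; rewrite lee_fin sqr_ge0.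
- by move=> k /packet_supported ->; rewrite cabs0 expr0n.
under eq_bigr do rewrite cabs_packet.
rewrite sumEFin lee_fin sumr_const card_ord exprVn sqr_sqrtr ?ler0n// expr1n.
by rewrite -[_ *+ _]mulr_natr mulVf// pnatr_eq0.
Qed.

(** The inner product of v with the packet. *)
Definition packet_coef k0 L x0 (v : int -> C) : C :=
  \sum_(j < L) (packet k0 L x0 (k0 + j%:Z))^*%C * v (k0 + j%:Z).

Lemma packet_coefB k0 L x0 v w : packet_coef k0 L x0 (v \- w) =
  packet_coef k0 L x0 v - packet_coef k0 L x0 w.
Proof. by rewrite /packet_coef -sumrB; apply: eq_bigr => j _; rewrite mulrBr. Qed.

Lemma cabs_conjc (z : C) : cabs z^*%C = cabs z.
Proof. by rewrite !cabsE; case: z => a b /=; rewrite sqrrN. Qed.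

Lemma packet_coef_le k0 L x0 v r : 0 <= r ->
  \sum_(j < L.+1) cabs (v (k0 + j%:Z)) ^+ 2 <= r ^+ 2 ->
  cabs (packet_coef k0 L.+1 x0 v) <= r.
Proof.
move=> r0 h; apply: le_trans (cabs_sum _ _ _) _.
under eq_bigr do rewrite cabsM cabs_conjc cabs_packet.
by rewrite -mulr_sumr; exact: sum_le_sqrt_card.
Qed.

Lemma packet_coef_le_sup k0 L x0 v d : 0 <= d ->
  (forall j : 'I_L.+1, cabs (v (k0 + j%:Z)) <= d) ->
  cabs (packet_coef k0 L.+1 x0 v) <= L.+1%:R * d.
Proof.
move=> d0 h; apply: packet_coef_le; first by rewrite mulr_ge0.
apply: (@le_trans _ _ (\sum_(j < L.+1) d ^+ 2)).
  by apply: ler_sum => j _; rewrite ler_pXn2r// nnegrE cabs_ge0.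
rewrite sumr_const card_ord -[_ *+ _]mulr_natl exprMn ler_wpM2r ?sqr_ge0//.
by rewrite -natrX ler_nat expnS expn1 leq_pmulr.
Qed.

Variable sigma : int -> R -> C.
Hypothesis csigma : forall k, ccontinuous (sigma k).

(** The part with sigma(k0 + j, x) is the quadratic form of the matrix of T_sigma.
The part with the constant sigma(k0, x0) uses that the Fejer kernel has mean 1:
by orthogonality of exponentials only the L.+1 diagonal terms survive. *)
Lemma packet_pdo_coef k0 L x0 :
  packet_coef k0 L.+1 x0 (pdo sigma (packet k0 L.+1 x0)) - sigma k0 x0 =
  ((2 * pi)^-1 / L.+1%:R)%:C * cintegral (fun x => \sum_(j < L.+1) \sum_(l < L.+1)
    expi ((j%:Z - l%:Z)%:~R * (x - x0)) * (sigma (k0 + j%:Z) x - sigma k0 x0)).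
Proof.
set c := (_ / _)%:C.
have ce (m : int) z : ccontinuous (fun x => expi (m%:~R * (x - x0)) * z : C).
  by apply: ccontinuousM; [exact: ccontinuous_expi_shift|exact: ccontinuous_cst].
have cs (m k : int) : ccontinuous (fun x => expi (m%:~R * (x - x0)) * sigma k x).
  by apply: ccontinuousM; first exact: ccontinuous_expi_shift.
have p0 : 2 * pi != 0 :> R by rewrite mulf_neq0// gt_eqF// pi_gt0.
have pdo_part : packet_coef k0 L.+1 x0 (pdo sigma (packet k0 L.+1 x0)) =
    c * \sum_(j < L.+1) \sum_(l < L.+1)
      cintegral (fun x => expi ((j%:Z - l%:Z)%:~R * (x - x0)) * sigma (k0
        + j%:Z) x).
  rewrite mulr_sumr; apply: eq_bigr => j _.
  rewrite (pdo_window (@packet_supported k0 L.+1 x0))// mulrCA !mulr_sumr.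
  apply: eq_bigr => l _; rewrite conjc_packet packetE.
  have -> : k0 + j%:Z - (k0 + l%:Z) = j%:Z - l%:Z by ring.
  have -> : (fun x => expi ((j%:Z - l%:Z)%:~R * (x - x0)) * sigma (k0 + j%:Z) x) =
     (fun x => expi (- ((k0 + j%:Z)%:~R * x0)) * expi ((k0 + l%:Z)%:~R * x0) *
        (expi ((j%:Z - l%:Z)%:~R * x) * sigma (k0 + j%:Z) x)).
    apply/funext => x; rewrite !mulrA -!expiD; congr (expi _ * _).
    rewrite !intrB !intrD; ring.
  rewrite cintegralZ; last first.
    by apply: ccontinuousM => //; under eq_fun do rewrite -[_ * _]addr0;
      exact: ccontinuous_expi.
  have -> : c = ((2 * pi)^-1)%:C * (((Num.sqrt L.+1%:R)^-1)%:C * ((Num.sqrt L.+1%:R)^-1)%:C).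
    by rewrite /c -!rmorphM /= -expr2 exprVn sqr_sqrtr.
  ring.
have cst_part : sigma k0 x0 = c * \sum_(j < L.+1) \sum_(l < L.+1)
      cintegral (fun x => expi ((j%:Z - l%:Z)%:~R * (x - x0)) * sigma k0 x0).
  under eq_bigr => j _.
    rewrite (bigD1 j)//= big1 => [|l lj].
      under eq_fun do rewrite mulrC.
      rewrite cintegralZ; last exact: ccontinuous_expi_shift.
      rewrite cintegral_expi_shift subrr eqxx addr0.
    over.
    under eq_fun do rewrite mulrC.
    rewrite cintegralZ; last exact: ccontinuous_expi_shift.
    rewrite cintegral_expi_shift ifF ?mulr0//.
    by apply/negbTE; rewrite subr_eq0 eqz_nat eq_sym.
  rewrite sumr_const card_ord -[_ *+ _]mulr_natl.
  have cL : c * (L.+1%:R * (2 * pi)%:C) = 1 :> C.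
    rewrite -(rmorph_nat (real_complex R)) /c -!rmorphM -[RHS](rmorph1 (real_complex R)).
    by congr (_%:C); rewrite mulrA divfK ?pnatr_eq0// mulVf.
  by rewrite [sigma k0 x0 * _]mulrC !mulrA in cL *; rewrite cL mul1r.
rewrite pdo_part [X in _ - X = _]cst_part -mulrBr; congr (_ * _).
rewrite -sumrB cintegral_sum => [|j]; last first.
  by apply: ccontinuous_sum => l; under eq_fun do rewrite mulrBr -mulrN;
    exact: ccontinuousD.
apply: eq_bigr => j _; rewrite -sumrB cintegral_sum => [|l]; last first.
  by under eq_fun do rewrite mulrBr -mulrN; exact: ccontinuousD.
apply: eq_bigr => l _; under [in RHS]eq_fun do rewrite mulrBr -mulrN.
rewrite cintegralD//; congr (_ + _).
under eq_fun do rewrite mulrC; under [in RHS]eq_fun do rewrite mulrC.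
rewrite !cintegralZ; try exact: ccontinuous_expi_shift.
by rewrite mulNr.
Qed.

(** The integrand is at most L.+1^2 eta + |D|^2 (e + M (1 - cos)), hence at most
e |D|^2 + (L.+1^2 eta + 2 M), where D is the Dirichlet kernel; the integral of
|D|^2 is 2 pi L.+1. *)
Lemma packet_pdo_estimate k0 L x0 e M eta :
  0 <= M -> 0 <= eta ->
  (forall x, x \in torus R -> cabs (sigma k0 x - sigma k0 x0) <=
    e + M * (1 - cos (x - x0))) ->
  (forall x (j : 'I_L.+1), cabs (sigma (k0 + j%:Z) x - sigma k0 x) <= eta) ->
  cabs (packet_coef k0 L.+1 x0 (pdo sigma (packet k0 L.+1 x0)) - sigma k0 x0) <=
  2 * (e + L.+1%:R * eta + 2 * M / L.+1%:R).
Proof.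
move=> M0 eta0 osc slow; rewrite packet_pdo_coef cabsM.
have p0 := @pi_gt0 R.
have Ln0 : (0 : R) < L.+1%:R by rewrite ltr0n.
pose D2 x : C := \sum_(j < L.+1) \sum_(l < L.+1) expi ((j%:Z - l%:Z)%:~R * (x - x0)).
have cD2 : ccontinuous D2.
  by apply: ccontinuous_sum => j; apply: ccontinuous_sum => l;
    exact: ccontinuous_expi_shift.
pose b : R := L.+1%:R ^+ 2 * eta + 2 * M.
(* The majorant is kept complex-valued so that cintegralD and cintegralZ
   compute its integral. *)
pose H x : C := e%:C * D2 x + b%:C.
have ceD2 : ccontinuous (fun x => e%:C * D2 x).
  by apply: ccontinuousM => //; exact: ccontinuous_cst.
have cH : ccontinuous H by apply: ccontinuousD => //; exact: ccontinuous_cst.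
have intH : cintegral H = (2 * pi * (e * L.+1%:R + b))%:C.
  rewrite cintegralD//; last exact: ccontinuous_cst.
  rewrite cintegralZ// cintegral_cst cintegral_sum => [|j]; last first.
    by apply: ccontinuous_sum => l; exact: ccontinuous_expi_shift.
  under eq_bigr => j _.
    rewrite cintegral_sum => [|l]; last exact: ccontinuous_expi_shift.
    rewrite (bigD1 j)//= big1 => [|l lj].
      rewrite cintegral_expi_shift subrr eqxx addr0.
    over.
    rewrite cintegral_expi_shift ifF//.
    by apply/negbTE; rewrite subr_eq0 eqz_nat eq_sym.
  rewrite sumr_const card_ord -rmorphMn -!rmorphM -rmorphD /=; congr (_%:C).
  by rewrite -mulr_natr; ring.
have HE x : cre H x = e * cabs (dirichlet L.+1 (x - x0)) ^+ 2 + b.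
  by rewrite /cre /H /D2 dirichlet_sqr /=; ring.
rewrite cabs_real ger0_norm; last by rewrite divr_ge0// invr_ge0 mulr_ge0// ltW.
rewrite mulrAC ler_pdivrMr// mulrC ler_pdivrMr ?mulr_gt0//.
apply: le_trans (@cabs_cintegral_le _ _ (cre H) _ cH.1 _) _.
- apply: ccontinuous_sum => j; apply: ccontinuous_sum => l.
  apply: ccontinuousM; first exact: ccontinuous_expi_shift.
  by apply: ccontinuousD => //; exact: ccontinuous_cst.
- move=> x tx; rewrite HE.
  have -> : \sum_(j < L.+1) \sum_(l < L.+1) expi ((j%:Z - l%:Z)%:~R * (x - x0)) *
       (sigma (k0 + j%:Z) x - sigma k0 x0) =
    \sum_(j < L.+1) \sum_(l < L.+1) expi ((j%:Z - l%:Z)%:~R * (x - x0)) *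
       (sigma (k0 + j%:Z) x - sigma k0 x) + D2 x * (sigma k0 x - sigma k0 x0).
    rewrite mulr_suml -big_split; apply: eq_bigr => j _ /=.
    rewrite mulr_suml -big_split; apply: eq_bigr => l _ /=; ring.
  apply: le_trans (cabsD _ _) _; rewrite /b addrCA; apply: lerD.
    apply: le_trans (cabs_sum _ _ _) _.
    have -> : L.+1%:R ^+ 2 * eta = \sum_(j < L.+1) \sum_(l < L.+1) eta.
      by rewrite !sumr_const card_ord -mulrnA -[RHS]mulr_natl natrM expr2.
    apply: ler_sum => j _; apply: le_trans (cabs_sum _ _ _) _.
    by apply: ler_sum => l _; rewrite cabsM cabs_expi mul1r.
  rewrite cabsM /D2 dirichlet_sqr cabs_real ger0_norm ?sqr_ge0//.
  apply: le_trans (ler_wpM2l (sqr_ge0 _) (osc x tx)) _.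
  have := dirichlet_bound L.+1 (x - x0).
  set d := cabs _ ^+ 2 => h; rewrite mulrDr mulrC lerD2l.
  by rewrite mulrCA [2 * _]mulrC ler_wpM2l// mulrC.
have -> : \int[mu]_(x in torus R) cre H x = complex.Re (cintegral H) by [].
rewrite intH /= /b; move: Ln0; set n := L.+1%:R => n0.
by rewrite le_eqVlt; apply/orP; left; apply/eqP; field; rewrite gt_eqF.
Qed.

End WavePacket.

(** * The lower bound for the norm *)

Section Compact.
Variable R : realType.
Local Notation C := R[i].

Lemma homo_ltn_ge (phi : nat -> nat) : {homo phi : i j / (i < j)%N} ->
  forall n, (n <= phi n)%N.
Proof. by move=> h; elim=> // n IH; rewrite (leq_ltn_trans IH)// h. Qed.

(** On a far window the entries of K u_n are close to those of the limit g, which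
are themselves small there.  Summing L.+1 small entries avoids adjoints and weak
convergence. *)
Lemma compact_packet_coef (K : (int -> C) -> int -> C) (L : nat)
    (k : nat -> int) (x : nat -> R) (e : R) :
  compact_operator K -> (forall n, (n <= absz (k n))%N) -> 0 < e ->
  forall N, exists2 n, (N <= n)%N &
    cabs (packet_coef (k n) L.+1 (x n) (K (packet (k n) L.+1 (x n)))) <= e.
Proof.
move=> [_ _ cK] kn e0 N; pose u n := packet (k n) L.+1 (x n).
have [|phi [g [hphi gl2 cv]]] := cK u; first by exists 1 => n; exact: l2norm_packet.
pose d := e / L.+1%:R / 2.
have d0 : 0 < d by rewrite !divr_gt0.
have [N1 h1] := l2norm_cvg0 cv d0.
have [N2 h2] := l2_vanishing gl2 d0.
pose n := (N + N1 + N2 + L.+1)%N.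
have np := homo_ltn_ge hphi n.
exists (phi n); first by rewrite /n in np *; lia.
have -> : e = L.+1%:R * (d + d) by rewrite /d -splitr mulrC divfK// pnatr_eq0.
apply: packet_coef_le_sup => [|j]; first by rewrite addr_ge0// ltW.
set m := k (phi n) + _.
rewrite -[K _ m](subrK (g m)); apply: le_trans (cabsD _ _) _; apply: lerD.
  apply: (@cabs_le_l2norm _ (K (u (phi n)) \- g)%R); first exact: ltW.
  by apply: h1; rewrite /n; lia.
apply/ltW/h2; have := kn (phi n); rewrite /m; have := ltn_ord j.
by move: np; rewrite /n; lia.
Qed.

Lemma symbol_limsup_gt (sigma : int -> R -> C) (c : R) :
  (c%:E < symbol_limsup sigma)%E -> forall N : nat,
  exists kx : int * R, [/\ (N <= absz kx.1)%N, kx.2 \in torus R & c < cabs (sigma kx.1 kx.2)].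
Proof.
move=> h N.
have : (c%:E < ereal_sup [set ereal_sup [set (cabs (sigma k x))%:E | x in torus R]
              | k in [set k : int | (N <= `|k|)%N]])%E.
  by apply: lt_le_trans h _; apply: ereal_inf_lbound; exists N.
move=> /ereal_sup_gt[_ [k kN <-]] /ereal_sup_gt[_ [x tx <-]].
by rewrite lte_fin => cs; exists (k, x); split=> //; rewrite inE.
Qed.

Lemma opnorm_packet_coef (A : (int -> C) -> int -> C) (r : R) k L x :
  0 <= r -> (opnorm A <= r%:E)%E ->
  cabs (packet_coef k L.+1 x (A (packet k L.+1 x))) <= r.
Proof.
move=> r0 hA; apply: packet_coef_le => //; apply: sum_window_le => //.
apply: le_trans hA; apply: ereal_sup_ubound; exists (packet k L.+1 x) => //=.
exact: l2norm_packet.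
Qed.

Lemma opnorm_ge0 (A : (int -> C) -> int -> C) : (0 <= opnorm A)%E.
Proof.
apply: (@le_trans _ _ (l2norm (A (packet 0 1 0)))); first exact: sqrte_ge0.
by apply: ereal_sup_ubound; exists (packet 0 1 0) => //=; exact: l2norm_packet.
Qed.

End Compact.

Theorem corollary4p9 (R : realType) (Lambda : int -> R) (mu rho : R)
  (hLambda : weight_function Lambda mu) (hrho : 0 < rho <= 1 / mu)
  (sigma : int -> R -> R[i]) (hsigma : symbol_class rho Lambda 0 sigma)
  (K : (int -> R[i]) -> int -> R[i]) (hK : compact_operator K) :
  (symbol_limsup sigma <= opnorm (fun f => pdo sigma f \- K f)%R)%E.
Proof.
set A := fun f => _.
suff main (r : R) : 0 <= r -> (opnorm A <= r%:E)%E ->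
  (symbol_limsup sigma <= r%:E)%E.
  case E : (opnorm A) (opnorm_ge0 A) => [r| |]; [|by move=> _; rewrite leey|].
    2: by rewrite leeNy_eq.
  by rewrite lee_fin => r0; apply: main => //; rewrite E.
move=> r0 hA; apply/lee_addgt0Pr => e e0; rewrite leNgt -EFinD;
  apply/negP => /symbol_limsup_gt lim.
have /andP[rho0 _] := hrho.
(* The final budget is e / 4 for K and 2 (e / 16), 2 (e / 16), 4 M / n <= e / 8
   for the three errors of the packet estimate, in total 5 e / 8 < e. *)
have e16 : 0 < e / 16 by lra.
have [M M0 osc] := symbol_oscillation hsigma e16.
pose L := Num.truncn (32 * M / e); pose n : R := L.+1%:R.
have n0 : 0 < n by rewrite ltr0n.
have ML : 4 * M / n <= e / 8.
  rewrite ler_pdivrMr//; have : 32 * M / e < n by rewrite /n truncnS_gt.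
  by rewrite ltr_pdivrMr//; lra.
have eta0 : 0 < e / 16 / n by rewrite divr_gt0.
have [N slow] := symbol_slow hLambda rho0 hsigma L.+1 eta0.
have /choice[kx hkx] := lim.
have [] := @compact_packet_coef R K L (fun i => (kx i).1)
  (fun i => (kx i).2) (e / 4) hK _ _ N.
- by move=> i; case: (hkx i).
- lra.
move=> i iN; have [ki xi ci] := hkx i;
  move: (kx i) ki xi ci => [k x] /= ki xi ci Kle.
have Tle := @packet_pdo_estimate R sigma (symbol_ccontinuous hsigma) k L x
  _ _ _ M0 (ltW eta0) (fun y ty => osc k y x ty xi)
  (fun y j => slow k y j (leq_trans iN ki) (ltn_ord j)).
have := opnorm_packet_coef k L x r0 hA; rewrite packet_coefB.
move: Tle Kle; rewrite -/n.
set T := packet_coef _ _ _ _; set Q := packet_coef _ _ _ _ => Tle Kle TQ.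
have : cabs (sigma k x) <= cabs (T - Q) + cabs Q + cabs (T - sigma k x).
  rewrite [X in cabs X <= _](_ : _ = T - Q + Q - (T - sigma k x)); last by ring.
  by rewrite (le_trans (cabsB _ _))// lerD2r cabsD.
move=> final.
have n1 : n * (e / 16 / n) = e / 16 by rewrite mulrC divfK ?gt_eqF.
have n2 : 2 * (2 * M / n) = 4 * M / n by ring.
rewrite n1 !mulrDr n2 in Tle.
move: ML Tle; set q := 4 * M / n => ML Tle.
have : cabs (T - sigma k x) <= e / 16 * 4 + e / 8 by lra.
have : r + e < r + e / 4 + cabs (T - sigma k x).
  by apply: lt_le_trans ci (le_trans final _); rewrite lerD2r lerD.
lra.
Qed.
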